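(* The Dirichlet-Neumann algorithm DN$_1$ (with relaxation parameter $\theta\in(0,1)$) converges for all initial guesses under the assumption that the matrix $A$ is not singular.
   Context: Let $A\in\mathbb{R}^{n\times n}$ be a diagonalizable matrix (for instance symmetric), $A=PDP^{-1}$ with $D=\mathrm{diag}(d_1,\dots,d_n)$, where $d_i$ are the eigenvalues of $A$; $A$ replaces the spatial operator $-\Delta$ after a semi-discretization in space (e.g. by finite differences) of a parabolic optimal control problem. Let $\nu>0$, $\gamma\ge 0$, $T>0$, and let the time interval $(0,T)$ be decomposed into $\Omega_1=(0,\alpha)$ and $\Omega_2=(\alpha,T)$ with interface $0<\alpha<T$. Algorithm DN$_1$ (error equations) with relaxation parameter $\theta\in(0,1)$: for each $i=1,\dots,n$, given an initial guess $f_i^0$, for $k=1,2,\dots$: (1) solve $\dot z_{1,i}^k+d_iz_{1,i}^k-\nu^{-1}\mu_{1,i}^k=0$, $\dot\mu_{1,i}^k-z_{1,i}^k-d_i\mu_{1,i}^k=0$ in $\Omega_1$ with $z_{1,i}^k(0)=0$, $\mu_{1,i}^k(\alpha)=f_i^{k-1}$; (2) solve $\dot z_{2,i}^k+d_iz_{2,i}^k-\nu^{-1}\mu_{2,i}^k=0$, $\dot\mu_{2,i}^k-z_{2,i}^k-d_i\mu_{2,i}^k=0$ in $\Omega_2$ with $\dot z_{2,i}^k(\alpha)=\dot z_{1,i}^k(\alpha)$, $\mu_{2,i}^k(T)+\gamma z_{2,i}^k(T)=0$; (3) set $f_i^k=(1-\theta)f_i^{k-1}+\theta\mu_{2,i}^k(\alpha)$.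 The algorithm converges for all initial guesses if $f_i^k\to 0$ as $k\to\infty$ for every $i$ and every initial guess $(f_1^0,\dots,f_n^0)$.
   Formalization: The eigenvalues d_i of A are assumed nonnegative, as for a discretized −Δ; without this the claim fails, e.g. for A = (−0.1), ν = 1, γ = 0, α = 1, T = 2, where the iteration diverges for every θ in (0,1). *)

(* Defs.v *)
From HB Require Import structures.
From mathcomp Require Import all_boot all_order all_algebra.
From mathcomp Require Import all_classical all_reals all_analysis.

Set Implicit Arguments.
Unset Strict Implicit.
Unset Printing Implicit Defensive.

Import Order.TTheory GRing.Theory Num.Theory.
Import numFieldNormedType.Exports.

Local Open Scope classical_set_scope.
Local Open Scope ring_scope.

(* Functions on a closed time interval [a, b] are represented by functions on
   R whose values outside [a, b] are irrelevant.  The system holds in ]a, b[,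
   and z, mu are continuous up to the end points, so that their boundary
   values are meaningful. *)
Definition optimality_system (R : realType) (nu d a b : R) (z mu : R -> R) :=
  [/\ derivable_oo_LRcontinuous z a b,
      derivable_oo_LRcontinuous mu a b &
      forall t, t \in `]a, b[ ->
        derive1 z t + d * z t - nu^-1 * mu t = 0 /\
        derive1 mu t - z t - d * mu t = 0].

Definition is_left_derive (R : realType) (z : R -> R) (a l : R) :=
  (fun t => (z t - z a) / (t - a)) @ a^'- --> l.

Definition is_right_derive (R : realType) (z : R -> R) (a l : R) :=
  (fun t => (z t - z a) / (t - a)) @ a^'+ --> l.

Definition dirichlet_step (R : realType) (nu alpha d g : R) (z1 mu1 : R -> R) :=
  [/\ optimality_system nu d 0 alpha z1 mu1, z1 0 = 0 & mu1 alpha = g].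

(* The transmission condition z2'(alpha) = z1'(alpha) involves the one-sided
   derivatives taken from the respective subinterval. *)
Definition neumann_step (R : realType) (nu gamma T alpha d : R)
    (z1 z2 mu2 : R -> R) :=
  [/\ optimality_system nu d alpha T z2 mu2,
      exists2 l, is_left_derive z1 alpha l & is_right_derive z2 alpha l &
      mu2 T + gamma * z2 T = 0].

(* One iteration, for the eigenvalue d, from f_i^(k-1) = g to f_i^k = g'. *)
Definition DN1_iteration (R : realType) (nu gamma T alpha theta d g g' : R) :=
  exists z1 mu1 z2 mu2 : R -> R,
    [/\ dirichlet_step nu alpha d g z1 mu1,
        neumann_step nu gamma T alpha d z1 z2 mu2 &
        g' = (1 - theta) * g + theta * mu2 alpha].

Definition DN1_run (R : realType) (n : nat) (nu gamma T alpha theta : R)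
    (d : 'rV[R]_n) (f : nat -> 'rV[R]_n) :=
  forall k i,
    DN1_iteration nu gamma T alpha theta (d 0 i) (f k 0 i) (f k.+1 0 i).

(* The subproblems are stated relationally, so the existence of a run is
   required explicitly; it keeps the convergence clause from being vacuous. *)
Definition DN1_converges (R : realType) (n : nat) (nu gamma T alpha theta : R)
    (d : 'rV[R]_n) :=
  forall f0 : 'rV[R]_n,
    (exists2 f, f 0%N = f0 & DN1_run nu gamma T alpha theta d f) /\
    (forall f, f 0%N = f0 -> DN1_run nu gamma T alpha theta d f ->
       forall i, (fun k => f k 0 i) @ \oo --> (0 : R)).

(* Main.v *)
Require Import Defs.
From HB Require Import structures.
From mathcomp Require Import all_boot all_order all_algebra.
From mathcomp Require Import all_classical all_reals all_analysis.
From mathcomp Require Import ring lra.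

Import Order.TTheory GRing.Theory Num.Theory.
Import numFieldNormedType.Exports.

Local Open Scope ring_scope.

(* Each eigenvalue d decouples into a 2x2 linear system with constant
   coefficients whose flow is explicit (eigenvalues +-s, s^2 = d^2 + 1/nu), so
   one iteration multiplies f by 1 - theta + theta rho, where
     rho = cosh(s alpha) / (cosh(s alpha) + (d / s) sinh(s alpha))
           * (1 - d L / K)
   and L, K > 0 come from the problem on ]alpha, T[.  Since d <= s and
   sinh <= cosh, d L <= K; hence 0 <= rho <= 1, and rho < 1 because d > 0, which
   is where the nonsingularity of A enters. *)

(** * Hyperbolic functions with rate s *)

Definition chs {R : realType} (s t : R) := (expR (s * t) + expR (- s * t)) / 2.

(** This is sinh(s t) / s: with this scaling [chs s] and [shs s] solve u'' = s^2 u with data (1, 0)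
    and (0, 1) at 0. *)
Definition shs {R : realType} (s t : R) :=
  (expR (s * t) - expR (- s * t)) / (2 * s).

Lemma is_derive_expRZ (R : realType) (k t : R) :
  is_derive t 1 (fun x => expR (k * x)) (k * expR (k * t)).
Proof.
have H : is_derive t 1 (fun x : R => k * x) k.
  by apply: is_derive_eq; rewrite /GRing.scale /= mulr1.
by have := @is_derive1_comp R expR (fun x => k * x) t _ k
  (is_derive_expR _) H; rewrite [X in is_derive _ _ _ X]mulrC.
Qed.

Lemma is_derive_chs (R : realType) (s t : R) : s != 0 ->
  is_derive t 1 (chs s) (s ^+ 2 * shs s t).
Proof.
move=> s0; have H1 := is_derive_expRZ R s t.
have H2 := is_derive_expRZ R (- s) t.
rewrite /chs; apply: is_derive_eq.
rewrite /shs /GRing.scale /=; field.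
exact: s0.
Qed.

Lemma is_derive_shs (R : realType) (s t : R) : s != 0 ->
  is_derive t 1 (shs s) (chs s t).
Proof.
move=> s0; have H1 := is_derive_expRZ R s t.
have H2 := is_derive_expRZ R (- s) t.
rewrite /shs; apply: is_derive_eq.
rewrite /chs /GRing.scale /=; field.
exact: s0.
Qed.

Lemma chs0 (R : realType) (s : R) : chs s 0 = 1.
Proof. by rewrite /chs !mulr0 expR0; field. Qed.

Lemma shs0 (R : realType) (s : R) : shs s 0 = 0.
Proof. by rewrite /shs !mulr0 expR0 subrr mul0r. Qed.

Lemma chs_gt0 (R : realType) (s t : R) : 0 < chs s t.
Proof. by rewrite /chs divr_gt0 // addr_gt0 // expR_gt0. Qed.

Lemma shs_gt0 (R : realType) (s t : R) : 0 < s -> 0 < t -> 0 < shs s t.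
Proof.
move=> s0 t0; rewrite /shs divr_gt0 ?mulr_gt0 // subr_gt0 ltr_expR.
by have := mulr_gt0 s0 t0; lra.
Qed.

(** The gap is exactly exp(- s t), whatever the sign of t. *)
Lemma mul_shs_le_chs (R : realType) (s t : R) : 0 < s -> s * shs s t <= chs s t.
Proof.
move=> s0; have e0 := expR_gt0 (- s * t).
have -> : s * shs s t = chs s t - expR (- s * t).
  by rewrite /shs /chs; field; rewrite gt_eqF.
lra.
Qed.

(** * Explicit flow of the 2x2 system *)

(* The components of exp(t M) (x, y) for M = [[-d, 1/nu], [1, d]]: since
   M^2 = s^2 I when s^2 = d^2 + 1/nu, exp(t M) = chs s t I + shs s t M. *)
Definition z_flow {R : realType} (nu d s x y t : R) :=
  chs s t * x + shs s t * (nu^-1 * y - d * x).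

Definition mu_flow {R : realType} (d s x y t : R) :=
  chs s t * y + shs s t * (x + d * y).

Lemma is_derive_z_flow (R : realType) (nu d s x y t : R) :
  0 < s -> s ^+ 2 = d ^+ 2 + nu^-1 ->
  is_derive t 1 (z_flow nu d s x y)
    (nu^-1 * mu_flow d s x y t - d * z_flow nu d s x y t).
Proof.
move=> s0 sE; have s1 : s != 0 by rewrite gt_eqF.
have H1 := is_derive_chs R s t s1; have H2 := is_derive_shs R s t s1.
rewrite /z_flow; apply: is_derive_eq; rewrite /mu_flow /GRing.scale /= sE; ring.
Qed.

Lemma is_derive_mu_flow (R : realType) (nu d s x y t : R) :
  0 < s -> s ^+ 2 = d ^+ 2 + nu^-1 ->
  is_derive t 1 (mu_flow d s x y)
    (z_flow nu d s x y t + d * mu_flow d s x y t).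
Proof.
move=> s0 sE; have s1 : s != 0 by rewrite gt_eqF.
have H1 := is_derive_chs R s t s1; have H2 := is_derive_shs R s t s1.
rewrite /mu_flow; apply: is_derive_eq; rewrite /z_flow /GRing.scale /= sE; ring.
Qed.

Lemma is_derive_shift (R : realType) (f : R -> R) (a t l : R) :
  is_derive (t - a) 1 f l -> is_derive t 1 (fun x => f (x - a)) l.
Proof.
move=> fl; have H : is_derive t 1 (fun x : R => x - a) 1.
  by apply: is_derive_eq; rewrite subr0.
by have := @is_derive1_comp R f (fun x => x - a) t l 1 fl H; rewrite mulr1.
Qed.

Lemma derivable_continuous_bnd (R : realType) (f : R -> R) (a b : R) :
  (forall t, derivable f t 1) -> derivable_oo_LRcontinuous f a b.
Proof.
move=> fd; have fc t : {for t, continuous f}.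
  by apply: differentiable_continuous; apply/derivable1_diffP.
split; first by move=> t _.
- exact/cvg_at_right_filter/fc.
- exact/cvg_at_left_filter/fc.
Qed.

Lemma flow_solution (R : realType) (nu d s x y a b : R) :
  0 < s -> s ^+ 2 = d ^+ 2 + nu^-1 ->
  optimality_system nu d a b (fun t => z_flow nu d s x y (t - a))
    (fun t => mu_flow d s x y (t - a)).
Proof.
move=> s0 sE.
have Hz t := is_derive_shift _ (z_flow nu d s x y) a t _
  (is_derive_z_flow _ nu d s x y _ s0 sE).
have Hm t := is_derive_shift _ (mu_flow d s x y) a t _
  (is_derive_mu_flow _ nu d s x y _ s0 sE).
split; try by apply: derivable_continuous_bnd => t; exact: ex_derive.
by move=> t _; rewrite !derive1E !derive_val; split; ring.
Qed.

(** * Uniqueness of solutions *)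

(** Integrating factor: u(x) exp(- k (x - a)) has zero derivative inside the interval and is
    continuous up to its ends, so the mean value theorem makes it constant. *)
Lemma linear_ode_unique (R : realType) (u : R -> R) (k a b : R) :
  derivable_oo_LRcontinuous u a b ->
  (forall t, t \in `]a, b[ -> derive1 u t = k * u t) ->
  forall t, t \in `[a, b] -> u t = u a * expR (k * (t - a)).
Proof.
move=> ud uk t /[!in_itv]/= /andP[at0 tb].
pose e x := expR (- k * (x - a)).
have eD (x : R) : is_derive x 1 e (- k * e x).
  exact: (is_derive_shift _ (fun y => expR (- k * y)) _ _ _
    (is_derive_expRZ _ _ _)).
suff W : u t * e t = u a * e a.
  have ea : e a = 1 by rewrite /e subrr mulr0 expR0.
  rewrite ea mulr1 in W; rewrite -W -mulrA -expRD.
  by rewrite -mulrDl addNr mul0r expR0 mulr1.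
move: at0; rewrite le_eqVlt => /predU1P[<- //|at0].
have [||c _] := @MVT R (fun x => u x * e x) (fun=> 0) a t at0.
- move=> x /[!in_itv]/= /andP[ax xt].
  have xab : x \in `]a, b[ by rewrite in_itv /= ax (lt_le_trans xt tb).
  have [du _ _] := ud.
  have uD : is_derive x 1 u (k * u x).
    by apply: DeriveDef; [exact: du|rewrite -derive1E uk].
  by apply: is_derive_eq; rewrite /GRing.scale /=; ring.
- move=> x; apply: continuousM.
  + apply: (@continuous_subspaceW _ _ _ `[a, b]%classic u).
      by apply: subset_itvl; rewrite bnd_simp.
    exact: derivable_oo_LRcontinuous_within.
  + apply: (@continuous_subspaceT _ _ _ e) => z.
    apply: differentiable_continuous; apply/derivable1_diffP.
    exact: ex_derive.
- by rewrite mul0r => /eqP; rewrite subr_eq0 => /eqP.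
Qed.

(** Left eigenvectors of M for s and - s split the system into two scalar equations. The difference
    of the two combinations isolates mu, and z then follows from either one. *)
Lemma flow_unique (R : realType) (nu d s a b : R) (z mu : R -> R) :
  0 < s -> s ^+ 2 = d ^+ 2 + nu^-1 -> optimality_system nu d a b z mu ->
  forall t, t \in `[a, b] ->
    z t = z_flow nu d s (z a) (mu a) (t - a) /\
    mu t = mu_flow d s (z a) (mu a) (t - a).
Proof.
move=> s0 sE [[dz rz lz] [dm rm lm] zm] t tab.
(* (1, c + d) is a left eigenvector of M for the eigenvalue c. *)
have eig c : c ^+ 2 = s ^+ 2 -> z t + (c + d) * mu t =
    (z a + (c + d) * mu a) * expR (c * (t - a)).
  move=> cE.
  apply: (@linear_ode_unique R (fun t => z t + (c + d) * mu t) c a b) => //.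
    split.
    - move=> x xab; apply: derivableD; first exact: dz.
      by apply: derivableM => //; exact: dm.
    - by apply: cvgD => //; apply: cvgM => //; exact: cvg_cst.
    - by apply: cvgD => //; apply: cvgM => //; exact: cvg_cst.
  move=> x xab; have [zE mE] := zm x xab.
  have zD : is_derive x 1 z (nu^-1 * mu x - d * z x).
    apply: DeriveDef; first exact: dz.
    by rewrite -derive1E; lra.
  have mD : is_derive x 1 mu (z x + d * mu x).
    apply: DeriveDef; first exact: dm.
    by rewrite -derive1E; lra.
  rewrite derive1E derive_val /GRing.scale /=.
  have -> : nu^-1 = c ^+ 2 - d ^+ 2 by rewrite cE sE; ring.
  ring.
have E1 := eig s erefl; have E2 := eig (- s) (sqrrN s).
have s1 : s != 0 by rewrite gt_eqF.
have muE : mu t = mu_flow d s (z a) (mu a) (t - a).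
  apply: (@mulfI _ (2 * s)); first by rewrite mulf_neq0.
  have -> : 2 * s * mu t = (z t + (s + d) * mu t) - (z t + (- s + d) * mu t).
    ring.
  rewrite E1 E2 /mu_flow /chs /shs; by field; exact: s1.
split => //.
have -> : z t = z t + (s + d) * mu t - (s + d) * mu t by ring.
have nuE : nu^-1 = s ^+ 2 - d ^+ 2 by rewrite sE; ring.
rewrite E1 muE /z_flow /mu_flow /chs /shs nuE; by field; exact: s1.
Qed.

(** * One-sided derivatives at the interface *)

(** A solution is arbitrary outside its interval, so its end-point derivative is read off from the
    explicit flow g, which is differentiable on the whole line. *)
Lemma is_left_derive_itv (R : realType) (f g : R -> R) (a b l : R) :
  a < b -> (forall t, t \in `[a, b] -> f t = g t) ->
  is_derive b 1 g l -> is_left_derive f b l.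
Proof.
move=> ab fg [gD gl]; rewrite /is_left_derive.
(* The derivative of g is a limit in the increment h as h tends to 0; h = t - b turns it into a
   limit in t from the left of b. *)
have shift : ((fun t => t - b) @ b^'- --> (0 : R)^')%classic.
  move=> A [e /= e0 He]; exists e => //= t /= bt tb.
  apply: He; last by rewrite subr_eq0 lt_eqF.
  by rewrite /= sub0r normrN -normrN opprB.
have := cvg_comp _ _ shift gD; rewrite -/(derive g b 1) gl => H.
apply: cvg_trans H; apply: near_eq_cvg.
near=> t.
have tb : t < b by near: t; exact: nbhs_left_lt.
have at' : a < t by near: t; exact: nbhs_left_gt.
rewrite /= !fg ?in_itv /= ?lexx ?(ltW ab) ?(ltW at') ?(ltW tb) //.
by rewrite /GRing.scale /= mulr1 subrK mulrC.
Unshelve. all: by end_near.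
Qed.

Lemma is_right_derive_itv (R : realType) (f g : R -> R) (a b l : R) :
  a < b -> (forall t, t \in `[a, b] -> f t = g t) ->
  is_derive a 1 g l -> is_right_derive f a l.
Proof.
move=> ab fg [gD gl]; rewrite /is_right_derive.
have shift : ((fun t => t - a) @ a^'+ --> (0 : R)^')%classic.
  move=> A [e /= e0 He]; exists e => //= t /= bt tb.
  apply: He; last by rewrite subr_eq0 gt_eqF.
  by rewrite /= sub0r normrN -normrN opprB.
have := cvg_comp _ _ shift gD; rewrite -/(derive g a 1) gl => H.
apply: cvg_trans H; apply: near_eq_cvg.
near=> t.
have tb : t < b by near: t; exact: nbhs_right_lt.
have at' : a < t by near: t; exact: nbhs_right_gt.
rewrite /= !fg ?in_itv /= ?lexx ?(ltW ab) ?(ltW at') ?(ltW tb) //.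
by rewrite /GRing.scale /= mulr1 subrK mulrC.
Unshelve. all: by end_near.
Qed.

Lemma solution_left_derive (R : realType) (nu d s a b : R) (z mu : R -> R) :
  0 < s -> s ^+ 2 = d ^+ 2 + nu^-1 -> a < b ->
  optimality_system nu d a b z mu ->
  is_left_derive z b (nu^-1 * mu b - d * z b).
Proof.
move=> s0 sE ab sol; have U := flow_unique _ _ _ _ _ _ _ _ s0 sE sol.
have bab : b \in `[a, b] by rewrite in_itv /= lexx ltW.
have [zb mb] := U b bab.
rewrite [in X in _ - X]zb [in X in X - _]mb.
apply: (@is_left_derive_itv R z
  (fun t => z_flow nu d s (z a) (mu a) (t - a)) a b) => //.
  by move=> t /U[].
apply: (is_derive_shift _ (z_flow nu d s (z a) (mu a))).
exact: is_derive_z_flow.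
Qed.

Lemma solution_right_derive (R : realType) (nu d s a b : R) (z mu : R -> R) :
  0 < s -> s ^+ 2 = d ^+ 2 + nu^-1 -> a < b ->
  optimality_system nu d a b z mu ->
  is_right_derive z a (nu^-1 * mu a - d * z a).
Proof.
move=> s0 sE ab sol; have U := flow_unique _ _ _ _ _ _ _ _ s0 sE sol.
have aab : a \in `[a, b] by rewrite in_itv /= lexx ltW.
have [za ma] := U a aab.
rewrite [in X in _ - X]za [in X in X - _]ma.
apply: (@is_right_derive_itv R z
  (fun t => z_flow nu d s (z a) (mu a) (t - a)) a b) => //.
  by move=> t /U[].
apply: (is_derive_shift _ (z_flow nu d s (z a) (mu a))).
exact: is_derive_z_flow.
Qed.

(** The equation for z extends to the end points with one-sided derivatives, so uniqueness of limits
    makes the transmission condition algebraic in the values at alpha. *)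
Lemma neumann_stepE (R : realType) (nu gamma T alpha d s : R)
    (z1 mu1 z2 mu2 : R -> R) :
  0 < s -> s ^+ 2 = d ^+ 2 + nu^-1 -> 0 < alpha -> alpha < T ->
  optimality_system nu d 0 alpha z1 mu1 ->
  neumann_step nu gamma T alpha d z1 z2 mu2 <->
  [/\ optimality_system nu d alpha T z2 mu2,
      nu^-1 * mu2 alpha - d * z2 alpha = nu^-1 * mu1 alpha - d * z1 alpha &
      mu2 T + gamma * z2 T = 0].
Proof.
move=> s0 sE alpha0 alphaT sol1.
have L1 := solution_left_derive _ _ _ _ _ _ _ _ s0 sE alpha0 sol1.
split=> [[sol2 [l lz1 rz2] bc]|[sol2 tr bc]]; split=> //.
  have R2 := solution_right_derive _ _ _ _ _ _ _ _ s0 sE alphaT sol2.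
  rewrite -(cvg_unique _ rz2 R2) ?(cvg_unique _ lz1 L1) //.
exists (nu^-1 * mu1 alpha - d * z1 alpha) => //.
by rewrite -tr; exact: solution_right_derive s0 sE alphaT sol2.
Qed.

(** * The contraction factor *)

(* With w = z'(alpha), the Neumann problem on [alpha, T] gives
   mu2 alpha = nu (1 - d L / K) w, where L and K come from expressing
   mu2 T + gamma z2 T = 0 in w and z2 alpha as  K z2 alpha + L w = 0. *)
Definition neumann_w_coef {R : realType} (nu gamma d s t : R) :=
  chs s t + d * shs s t + gamma / nu * shs s t.

Definition neumann_z_coef {R : realType} (nu gamma d s t : R) :=
  d * chs s t + s ^+ 2 * shs s t + gamma / nu * chs s t.

(** The first factor takes g to nu w = chs s alpha * mu1 0 (Dirichlet step), the second takes nu w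
    to mu2 alpha (Neumann step). *)
Definition DN1_factor {R : realType} (nu gamma T alpha d s : R) :=
  chs s alpha / (chs s alpha + d * shs s alpha) *
  (1 - d * neumann_w_coef nu gamma d s (T - alpha) /
       neumann_z_coef nu gamma d s (T - alpha)).

Lemma neumann_w_coef_gt0 (R : realType) (nu gamma d s t : R) :
  0 < nu -> 0 <= gamma -> 0 <= d -> 0 < s -> 0 < t ->
  0 < neumann_w_coef nu gamma d s t.
Proof.
move=> nu0 g0 d0 s0 t0; have S0 := ltW (shs_gt0 _ _ _ s0 t0).
have C0 := chs_gt0 _ s t; have dS := mulr_ge0 d0 S0.
have gS := mulr_ge0 (divr_ge0 g0 (ltW nu0)) S0.
by rewrite /neumann_w_coef; lra.
Qed.

Lemma neumann_z_coef_gt0 (R : realType) (nu gamma d s t : R) :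
  0 < nu -> 0 <= gamma -> 0 <= d -> 0 < s -> 0 < t ->
  0 < neumann_z_coef nu gamma d s t.
Proof.
move=> nu0 g0 d0 s0 t0; have S0 := shs_gt0 _ _ _ s0 t0.
have C0 := chs_gt0 _ s t.
have dC := mulr_ge0 d0 (ltW C0).
have sS : 0 < s ^+ 2 * shs s t by rewrite mulr_gt0 // exprn_gt0.
have gC := mulr_ge0 (divr_ge0 g0 (ltW nu0)) (ltW C0).
by rewrite /neumann_z_coef; lra.
Qed.

Lemma DN1_factor_itv (R : realType) (nu gamma T alpha d s : R) :
  0 < nu -> 0 <= gamma -> 0 < alpha -> alpha < T -> 0 < d -> d <= s ->
  0 <= DN1_factor nu gamma T alpha d s < 1.
Proof.
move=> nu0 g0 alpha0 alphaT d0 ds; have s0 := lt_le_trans d0 ds.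
have t0 : 0 < T - alpha by rewrite subr_gt0.
have L0 := neumann_w_coef_gt0 _ _ _ _ _ _ nu0 g0 (ltW d0) s0 t0.
have K0 := neumann_z_coef_gt0 _ _ _ _ _ _ nu0 g0 (ltW d0) s0 t0.
(* Term by term: the d [chs] terms agree, d^2 <= s^2 handles the [shs] terms, and d [shs] <= s [shs]
   <= [chs] the gamma terms. *)
have LK : d * neumann_w_coef nu gamma d s (T - alpha) <=
    neumann_z_coef nu gamma d s (T - alpha).
  have S0 := ltW (shs_gt0 _ _ _ s0 t0).
  have sC := mul_shs_le_chs _ s (T - alpha) s0.
  have dS : d * shs s (T - alpha) <= chs s (T - alpha).
    by apply: le_trans sC; rewrite ler_wpM2r.
  have dsS : d ^+ 2 * shs s (T - alpha) <= s ^+ 2 * shs s (T - alpha).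
    by rewrite ler_wpM2r // lerXn2r // nnegrE ltW.
  have gS := ler_wpM2l (divr_ge0 g0 (ltW nu0)) dS.
  rewrite /neumann_w_coef /neumann_z_coef; lra.
have C0 := chs_gt0 _ s alpha.
have dS0 : 0 < d * shs s alpha by rewrite mulr_gt0 ?shs_gt0.
have D0 := addr_gt0 C0 dS0.
have r0 : 0 <= chs s alpha / (chs s alpha + d * shs s alpha).
  by rewrite divr_ge0 ?ltW.
have q1 : d * neumann_w_coef nu gamma d s (T - alpha) /
    neumann_z_coef nu gamma d s (T - alpha) <= 1 by rewrite ler_pdivrMr ?mul1r.
have q0 : 0 < d * neumann_w_coef nu gamma d s (T - alpha) /
    neumann_z_coef nu gamma d s (T - alpha) by rewrite divr_gt0 ?mulr_gt0.
have r1 : chs s alpha / (chs s alpha + d * shs s alpha) <= 1.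
  by rewrite ler_pdivrMr ?mul1r // lerDl ltW.
rewrite /DN1_factor mulr_ge0 ?subr_ge0 //=.
(* Strictness comes from the second factor alone, through [q0]. *)
apply: (@le_lt_trans _ _ (1 * (1 - d * neumann_w_coef nu gamma d s (T - alpha) /
    neumann_z_coef nu gamma d s (T - alpha)))).
  by rewrite ler_wpM2r // subr_ge0.
by rewrite mul1r ltrBlDr ltrDl.
Qed.

(** * One iteration as a scalar multiplication, and convergence *)

(** Solutions are determined by their values at the left end, so the boundary and transmission
    conditions become linear equations in mu1 0, z2 alpha and mu2 alpha; d >= 0 keeps the pivots
    nonzero. Left to right controls every run, right to left provides one. *)
Lemma DN1_iterationP (R : realType) (nu gamma T alpha theta d s g g' : R) :
  0 < nu -> 0 <= gamma -> 0 < alpha -> alpha < T -> 0 <= d ->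
  0 < s -> s ^+ 2 = d ^+ 2 + nu^-1 ->
  DN1_iteration nu gamma T alpha theta d g g' <->
  g' = (1 - theta + theta * DN1_factor nu gamma T alpha d s) * g.
Proof.
move=> nu0 g0 alpha0 alphaT d0 s0 sE.
have t0 : 0 < T - alpha by rewrite subr_gt0.
have nu1 : nu != 0 by rewrite gt_eqF.
have D0 : chs s alpha + d * shs s alpha != 0.
  by rewrite gt_eqF // ltr_wpDr ?chs_gt0 // mulr_ge0 // ltW ?shs_gt0.
have K1 : neumann_z_coef nu gamma d s (T - alpha) != 0.
  by rewrite gt_eqF // neumann_z_coef_gt0.
split.
- case=> [z1 [mu1 [z2 [mu2 [[sol1 z10 mug] neu ->]]]]].
  have alphaI : alpha \in `[0, alpha] by rewrite in_itv /= lexx ltW.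
  have [] := flow_unique _ _ _ _ _ _ _ _ s0 sE sol1 _ alphaI.
  rewrite z10 mug subr0 => z1a mu1a.
  have [sol2 tr bc] := (neumann_stepE _ _ _ _ _ _ _ _ _ _ _
    s0 sE alpha0 alphaT sol1).1 neu.
  have TI : T \in `[alpha, T] by rewrite in_itv /= lexx ltW.
  have [z2T mu2T] := flow_unique _ _ _ _ _ _ _ _ s0 sE sol2 _ TI.
  suff -> : mu2 alpha = DN1_factor nu gamma T alpha d s * g by ring.
  set m := mu1 0 in z1a mu1a; set x := z2 alpha in tr z2T mu2T.
  (* Since z1 0 = 0, the [shs] terms cancel in z1'(alpha), leaving w = nu^-1 * chs s alpha * m. *)
  have mu2E : mu2 alpha = nu * d * x + chs s alpha * m.
    have -> : mu2 alpha = nu * (nu^-1 * mu2 alpha - d * x) + nu * d * x.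
      by field.
    rewrite tr mug mu1a z1a /z_flow /mu_flow; by field.
  have xE : x = - (nu^-1 * chs s alpha * m *
      neumann_w_coef nu gamma d s (T - alpha)) /
      neumann_z_coef nu gamma d s (T - alpha).
    apply: (mulIf K1); rewrite mulfVK //; apply/eqP.
    (* The condition at T reads nu (K x + L w) = 0, hence the factor nu^-1. *)
    rewrite -subr_eq0; apply/eqP; rewrite -(mulr0 nu^-1) -bc z2T mu2T mu2E.
    rewrite /neumann_z_coef /neumann_w_coef /mu_flow /z_flow sE; by field.
  rewrite mu2E xE mu1a /DN1_factor /mu_flow.
  by field; rewrite K1 nu1 D0.
(* The forward computation read backwards: m is mu1 0, w the common derivative at alpha, and (x, y)
   the values of (z2, mu2) there. *)
- move=> ->; pose m := g / (chs s alpha + d * shs s alpha).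
  pose w := nu^-1 * chs s alpha * m.
  pose x := - (w * neumann_w_coef nu gamma d s (T - alpha) /
    neumann_z_coef nu gamma d s (T - alpha)).
  pose y := nu * (w + d * x).
  have sol1 := flow_solution _ _ _ _ 0 m 0 alpha s0 sE.
  have sol2 := flow_solution _ _ _ _ x y alpha T s0 sE.
  exists (fun t => z_flow nu d s 0 m (t - 0)),
    (fun t => mu_flow d s 0 m (t - 0)).
  exists (fun t => z_flow nu d s x y (t - alpha)),
    (fun t => mu_flow d s x y (t - alpha)).
  split.
  + split => //; rewrite /z_flow /mu_flow !subr0 ?chs0 ?shs0;
      rewrite ?mulr0 ?mul0r ?addr0 //.
    by rewrite /m; field.
  + apply/(neumann_stepE _ _ _ _ _ _ _ _ _ _ _ s0 sE alpha0 alphaT sol1).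
    split => //.
    * rewrite !subrr /z_flow /mu_flow chs0 shs0 subr0 /y /w; by field.
    * have -> : mu_flow d s x y (T - alpha) +
          gamma * z_flow nu d s x y (T - alpha) = nu *
          (neumann_z_coef nu gamma d s (T - alpha) * x +
           neumann_w_coef nu gamma d s (T - alpha) * w).
        rewrite /neumann_z_coef /neumann_w_coef /mu_flow /z_flow sE /y.
        by field.
      by rewrite /x; field.
  + rewrite subrr /mu_flow chs0 shs0 /y /x /w /m /DN1_factor; field.
    by rewrite nu1 K1 D0.
Qed.

(* A stands for a semi-discretized -Laplacian: its eigenvalues d_i are
   nonnegative (hd). *)
Theorem theorem2 (R : realType) (n : nat) (A P : 'M[R]_n) (d : 'rV[R]_n)
    (nu gamma T alpha theta : R)
    (hP : P \in unitmx) (hA : A = P *m diag_mx d *m invmx P)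
    (hd : forall i, 0 <= d 0 i)
    (hnu : 0 < nu) (hgamma : 0 <= gamma)
    (halpha : 0 < alpha) (halphaT : alpha < T)
    (htheta0 : 0 < theta) (htheta1 : theta < 1)
    (hAns : A \in unitmx) :
  DN1_converges nu gamma T alpha theta d.
Proof.
(* Invertibility of A passes to [diag_mx d], whose determinant is the product of the eigenvalues. *)
have dpos i : 0 < d 0 i.
  rewrite lt_neqAle hd andbT eq_sym; move: hAns; rewrite hA !unitmx_mul.
  case/andP => /andP[_ +] _; rewrite unitmxE det_diag unitfE.
  by move/prodf_neq0; apply.
pose s i := Num.sqrt (d 0 i ^+ 2 + nu^-1).
have nuV0 : 0 < nu^-1 by rewrite invr_gt0.
have s2 i : s i ^+ 2 = d 0 i ^+ 2 + nu^-1.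
  by rewrite sqr_sqrtr // addr_ge0 ?sqr_ge0 // ltW.
have s0 i : 0 < s i by rewrite sqrtr_gt0 ltr_wpDl ?sqr_ge0.
have ds i : d 0 i <= s i.
  rewrite -(@ler_pXn2r _ 2) ?nnegrE ?(ltW (dpos i)) ?(ltW (s0 i)) //.
  by rewrite s2 lerDl ltW.
pose c i := 1 - theta + theta * DN1_factor nu gamma T alpha (d 0 i) (s i).
have iterE i g g' : DN1_iteration nu gamma T alpha theta (d 0 i) g g' <->
    g' = c i * g by apply: DN1_iterationP.
(* c i is a convex combination of 1 and a factor in [0, 1[ with weight theta > 0 on the latter, so 0
   < 1 - theta <= c i < 1. *)
have c1 i : `|c i| < 1.
  have /andP[r0 r1] := DN1_factor_itv _ _ _ T alpha (d 0 i) (s i)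
    hnu hgamma halpha halphaT (dpos i) (ds i).
  have tr0 := mulr_ge0 (ltW htheta0) r0.
  have tr1 : theta * DN1_factor nu gamma T alpha (d 0 i) (s i) < theta.
    by rewrite gtr_pMr.
  by rewrite /c ger0_norm; lra.
(* By [iterE] the geometric sequences with ratios c i form a run, and every run is of this form. *)
move=> f0; split.
  exists (fun k => \row_i (c i ^+ k * f0 0 i)).
    by apply/rowP => i; rewrite mxE expr0 mul1r.
  by move=> k i; apply/iterE; rewrite !mxE exprS mulrA.
move=> f ff0 run i.
have -> : (fun k => f k 0 i) = geometric (f0 0 i) (c i).
  apply/funext => k; elim: k => [|k IH]; first by rewrite /= expr0 mulr1 ff0.
  by have /iterE -> := run k i; rewrite IH /= exprS mulrCA.
exact: cvg_geometric.
Qed.
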